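(* Let $I$ be a proper monomial ideal in a polynomial ring $R$ in finitely many variables over a field. Suppose that $b_0, \ldots, b_{t}$ are distinct variables of $R$ and $>$ is a fixed term order on $R$ such that $b_0 > b_1 > \cdots > b_{t}$. Suppose that for some $1\le q \le t$ each of the sets $\{b_{0},b_{1}\}, \{b_1, b_2\}, \ldots, \{b_{q-2}, b_{q-1}\}, \{b_{q-1}, b_q, \ldots, b_{t}\}$ satisfies the following, where the first listed element of the set is regarded as its distinguished element: (1) $d_b(I)\le 1$ for every non-distinguished element $b$ of the set; and (2) if a minimal monomial generator $M$ of $I$ is divisible by the distinguished element of the set, then $M$ is divisible by some non-distinguished element of the set. Let $f_i = b_{i-1}+b_i$ for $1 \le i \le q-1$, and $f_q=b_{q-1}+b_q+\cdots+b_{t}$. Then $f_1, \ldots, f_q$ is both a regular sequence and an initially regular sequence on $R/I$ (the latter with respect to $>$).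
   Context: $\mathfrak m$ is the ideal of $R$ generated by all the variables. A term order is a monomial order (a total order on monomials, compatible with multiplication, with $1$ smallest), and $\mathrm{in}(J)$ is the initial ideal of $J$ with respect to the fixed term order. For a monomial ideal $J$ and a variable $x$, $d_x(J)$ is the maximum exponent of $x$ in the minimal monomial generators of $J$ (and $0$ if $J=0$). An element $f\in\mathfrak m$ is regular on $R/J$ if it is a non-zerodivisor on $R/J$. A sequence $f_1,\dots,f_q\in\mathfrak m$ is a regular sequence on $R/I$ if $f_i$ is regular on $R/(I,f_1,\dots,f_{i-1})$ for each $i$. It is an initially regular sequence on $R/I$ ($I$ proper, $f_i$ nonconstant) if for each $i=1,\dots,q$, $f_i$ is regular on $R/I_i$, where $I_1=\mathrm{in}(I)$ and $I_i=\mathrm{in}\big((I_{i-1},f_{i-1})\big)$ for $i\ge 2$. *)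

(* Defs.v *)
From HB Require Import structures.
From mathcomp Require Import all_boot all_order all_algebra.
From mathcomp Require Import mpoly.

Set Implicit Arguments.
Unset Strict Implicit.
Unset Printing Implicit Defensive.

Import GRing.Theory.
Local Open Scope ring_scope.

(* Subsets of the polynomial ring, in particular its ideals, are Prop-valued
   predicates, compared extensionally. *)
Definition polyset (K : fieldType) (n : nat) := {mpoly K[n]} -> Prop.

Section Ideals.
Variables (K : fieldType) (n : nat).
Implicit Types (f g p : {mpoly K[n]}) (J S : polyset K n).
Implicit Types (m : 'X_{1..n}) (G : 'X_{1..n} -> Prop) (x : 'I_n).

Definition ideal_gen S : polyset K n := fun p =>
  exists cs : seq ({mpoly K[n]} * {mpoly K[n]}),
    (forall c, c \in cs -> S c.2) /\ p = \sum_(c <- cs) c.1 * c.2.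

(* The ideal (J, f_1, ..., f_r) for fs = [:: f_1; ...; f_r]. *)
Definition adjoin J (fs : seq {mpoly K[n]}) : polyset K n :=
  ideal_gen (fun p => J p \/ p \in fs).

Definition maxideal : polyset K n :=
  ideal_gen (fun p => exists x, p = 'X_x).

Definition is_proper J : Prop := ~ J 1.

Definition generated_by_monomials J G : Prop :=
  forall p, J p <-> ideal_gen (fun g => exists2 m, G m & g = 'X_[m]) p.

Definition monomial_ideal J : Prop := exists G, generated_by_monomials J G.

Definition minimal_monomial_generators J G : Prop :=
  generated_by_monomials J G /\
  forall G', (forall m, G' m -> G m) -> generated_by_monomials J G' ->
    forall m, G m -> G' m.

(* A monomial ideal has exactly one minimal set of monomial generators. *)
Definition min_gen J m : Prop :=
  exists2 G, minimal_monomial_generators J G & G m.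

(* [is_d J x d] means d_x(J) = d. *)
Definition is_d J x (d : nat) : Prop :=
  ((forall p, J p -> p = 0) /\ d = 0%N) \/
  ((exists2 m, min_gen J m & m x = d) /\
   forall m, min_gen J m -> (m x <= d)%N).

(* Conditions on a set {a} \cup B of variables whose distinguished element is
   a, B being the set of its other elements. *)
Definition star_condition J (a : 'I_n) (B : {set 'I_n}) : Prop :=
  (forall b, b \in B -> exists2 d, is_d J b d & (d <= 1)%N) /\
  (forall m, min_gen J m -> (U_(a) <= m)%MM ->
     exists2 b, b \in B & (U_(b) <= m)%MM).

(* f g = 0 in R/J only if g = 0 in R/J. *)
Definition regular_on J f : Prop :=
  maxideal f /\ forall g, J (f * g) -> J g.

Definition regular_sequence J (fs : seq {mpoly K[n]}) : Prop :=
  forall i, (i < size fs)%N -> regular_on (adjoin J (take i fs)) fs`_i.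

Section TermOrder.
Variable le : rel 'X_{1..n}.

Definition term_order : Prop :=
  [/\ reflexive le, antisymmetric le, transitive le & total le] /\
  (forall m1 m2 m, le m1 m2 -> le (m1 + m)%MM (m2 + m)%MM) /\
  (forall m, le 0%MM m).

Definition term_lt m1 m2 : bool := (m1 != m2) && le m1 m2.

Definition is_lead f m : Prop :=
  m \in msupp f /\ forall m', m' \in msupp f -> le m' m.

(* No condition f <> 0 is needed: 0 has empty support, hence no leading
   monomial. *)
Definition initial_ideal J : polyset K n :=
  ideal_gen (fun p => exists f m, [/\ J f, is_lead f m & p = 'X_[m]]).

(* in((... in((in(J), f_1)) ..., f_r)) for fs = [:: f_1; ...; f_r]. *)
Definition iterated_initial J (fs : seq {mpoly K[n]}) : polyset K n :=
  foldl (fun J' f => initial_ideal (adjoin J' [:: f])) (initial_ideal J) fs.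

Definition initially_regular_sequence J (fs : seq {mpoly K[n]}) : Prop :=
  [/\ is_proper J,
      forall f, f \in fs -> ~ exists c : K, f = c%:MP
    & forall i, (i < size fs)%N ->
        regular_on (iterated_initial J (take i fs)) fs`_i].

End TermOrder.

End Ideals.

Arguments regular_sequence {K n} J fs.
Arguments initially_regular_sequence {K n} le J fs.

(* f_i for the list of variables b_0, ..., b_t; meaningful for 1 <= i <= q only. *)
Definition star_form (K : fieldType) (n : nat) (b : nat -> 'I_n) (q t i : nat) :
    {mpoly K[n]} :=
  if (i < q)%N then 'X_(b i.-1) + 'X_(b i)
  else \sum_(q.-1 <= j < t.+1) 'X_(b j).

(* Main.v *)
(** Regularity of a sum of variables [a + b_1 + ... + b_r] modulo a monomial
    ideal follows from its star condition by looking at monomials of extremal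
    degree in one variable.  Killing [a + c] modulo a monomial ideal [I] amounts
    to substituting [- c] for [a], which sends monomials to signed monomials.
    Hence [(I, a + c)] is the preimage of the monomial ideal [I'] generated by
    the image of [I], and its initial ideal is [(I', a)] as soon as [a > c].
    Both [I'] and [(I', a)] inherit the star conditions for the remaining sets of
    variables, so that one can argue by induction on the length of the sequence
    for both notions of regularity. *)
Require Import Defs.
From mathcomp Require Import all_boot all_order all_algebra.
From mathcomp Require Import mpoly.
From mathcomp Require Import zify.
From Stdlib Require Import Classical.

Set Implicit Arguments.
Unset Strict Implicit.
Unset Printing Implicit Defensive.

Import GRing.Theory.
Local Open Scope ring_scope.

(** * Closure properties of generated ideals *)

Section IdealGen.
Variables (K : fieldType) (n : nat).
Implicit Types (S P J : polyset K n) (f g p c : {mpoly K[n]}).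

Lemma mem_ideal_gen S p : S p -> ideal_gen S p.
Proof.
move=> Sp; exists [:: (1, p)]; split; last by rewrite big_seq1 mul1r.
by move=> c; rewrite inE => /eqP ->.
Qed.

Lemma ideal_gen0 S : ideal_gen S 0.
Proof. by exists [::]; rewrite big_nil. Qed.

Lemma ideal_genD S p1 p2 : ideal_gen S p1 -> ideal_gen S p2 -> ideal_gen S (p1 + p2).
Proof.
move=> [cs1 [S1 ->]] [cs2 [S2 ->]]; exists (cs1 ++ cs2); split.
  by move=> c; rewrite mem_cat => /orP[/S1|/S2].
by rewrite big_cat.
Qed.

Lemma ideal_genMl S c p : ideal_gen S p -> ideal_gen S (c * p).
Proof.
move=> [cs [Scs ->]]; exists [seq (c * d.1, d.2) | d <- cs]; split.
  by move=> _ /mapP[d /Scs Sd ->].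
by rewrite big_map mulr_sumr; apply: eq_bigr => d _; rewrite mulrA.
Qed.

Lemma ideal_gen_ind S P :
  P 0 -> (forall p1 p2, P p1 -> P p2 -> P (p1 + p2)) ->
  (forall c p, S p -> P (c * p)) -> forall p, ideal_gen S p -> P p.
Proof.
move=> P0 PD PM p [cs [Scs ->]]; rewrite big_seq.
by elim/big_ind: _ => // d /Scs /PM.
Qed.

End IdealGen.

(** * Monomial ideals as sets of exponents *)

Section MonomialIdeals.
Variables (K : fieldType) (n : nat).
Implicit Types (J : polyset K n) (f g p : {mpoly K[n]}).
Implicit Types (A G : 'X_{1..n} -> Prop) (m : 'X_{1..n}).

Definition up_closed A : Prop := forall m m', A m -> (m <= m')%MM -> A m'.

(** Encodes that [J] is the linear span of the monomials with exponent in [A]. When [A] is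
    up-closed, [J] is a monomial ideal, and questions about it become combinatorics of exponents. *)
Definition monomials_in J A : Prop :=
  forall p, J p <-> forall m, m \in msupp p -> A m.

Definition up_set G m : Prop := exists2 g, G g & (g <= m)%MM.

Lemma up_set_closed G : up_closed (up_set G).
Proof. by move=> m m' [g Gg le_gm] le_mm'; exists g => //; apply: lepm_trans le_mm'. Qed.

Lemma monomials_inX J A m : monomials_in J A -> J 'X_[m] <-> A m.
Proof.
move=> JA; rewrite JA; split=> [|Am m']; first by apply; rewrite msuppX mem_head.
by rewrite msuppX inE => /eqP ->.
Qed.

Lemma msupp_subset_sum (T : eqType) (s : seq T) (F : T -> {mpoly K[n]}) m :
  m \in msupp (\sum_(x <- s) F x) -> exists2 x, x \in s & m \in msupp (F x).
Proof.
move/msupp_sum_le/flattenP => [l /mapP[x]]; rewrite filter_predT => xs -> mx.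
by exists x.
Qed.

Lemma msuppMX_mem p m m' :
  reflect (exists2 m1, m1 \in msupp p & m' = m + m1)%MM (m' \in msupp (p * 'X_[m])).
Proof. by rewrite (perm_mem (msuppMX p m)); apply: mapP. Qed.

(** Multiplying by a monomial only shifts supports, so combinations of generators have support above
    [G]. Conversely each term of [p] is a multiple of some generator. *)
Lemma monomials_in_gen G :
  monomials_in (ideal_gen (fun g : {mpoly K[n]} => exists2 m, G m & g = 'X_[m])) (up_set G).
Proof.
move=> p; split.
  move: p; apply: ideal_gen_ind => [m|p1 p2 H1 H2 m|c _ [m Gm ->] m'].
  - by rewrite msupp0.
  - by move/msuppD_le; rewrite mem_cat => /orP[/H1|/H2].
  - case/msuppMX_mem=> m1 _ ->; exists m => //; exact: lem_addr.
move=> H; rewrite [p]mpolyE big_seq; elim/big_ind: _ => [||m /H [g Gg le_gm]].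
- exact: ideal_gen0.
- exact: ideal_genD.
rewrite -mul_mpolyC -(submK le_gm) mpolyXD mulrA.
by apply/ideal_genMl/mem_ideal_gen; exists g.
Qed.

Lemma monomials_in_generated J G :
  generated_by_monomials J G <-> monomials_in J (up_set G).
Proof. by split=> H p; rewrite H monomials_in_gen. Qed.

Lemma monomials_in_ideal J : monomial_ideal J ->
  monomials_in J (fun m => J 'X_[m]) /\ up_closed (fun m => J 'X_[m]).
Proof.
case=> G /monomials_in_generated JG; split=> [p|m m'].
  by rewrite JG; split=> H m /H; rewrite (monomials_inX _ JG).
by rewrite !(monomials_inX _ JG); apply: up_set_closed.
Qed.

End MonomialIdeals.

(** * The star condition on exponents, and regularity of a sum of variables *)

Section StarCondition.
Variables (K : fieldType) (n : nat).
Implicit Types (J : polyset K n) (f g p : {mpoly K[n]}).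
Implicit Types (A G : 'X_{1..n} -> Prop) (m : 'X_{1..n}).
Implicit Types (a b : 'I_n) (B : seq 'I_n).

Definition minimal_in A m : Prop :=
  A m /\ forall m', A m' -> (m' <= m)%MM -> m' = m.

(** Proper divisibility lowers the degree, so strong induction on [mdeg m] applies. *)
Lemma minimal_below A m : A m -> exists2 g, minimal_in A g & (g <= m)%MM.
Proof.
have [k] := ubnP (mdeg m); elim: k m => // k IH m lt_mk Am.
have [min_m|] := classic (minimal_in A m); first by exists m => //; exact: lepm_refl.
move=> nmin; have [m' [Am' le_m'm ne_m'm]] :
    exists m', [/\ A m', (m' <= m)%MM & m' <> m].
  apply: NNPP => none; apply: nmin; split=> // m' Am' le_m'm.
  by apply: NNPP => ne; apply: none; exists m'.
have lt_m'm : (mdeg m' < mdeg m)%N.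
  rewrite -(submK le_m'm) mdegD -[ltnLHS]add0n ltn_add2r lt0n mdeg_eq0.
  by apply/eqP => d0; apply: ne_m'm; rewrite -[RHS](submK le_m'm) d0 add0m.
have [|//|g min_g le_gm'] := IH m'; first by lia.
by exists g => //; apply: lepm_trans le_m'm.
Qed.

(** The divisibility-minimal monomials of [J] generate it, and no generating set of monomials of [J]
    can omit one of them. *)
Lemma min_gen_minimal J m :
  monomial_ideal J -> minimal_in (fun m => J 'X_[m]) m -> min_gen J m.
Proof.
move=> /monomials_in_ideal[JA upA] min_m.
exists (minimal_in (fun m => J 'X_[m])) => //; split.
  apply/monomials_in_generated => p; rewrite JA; split=> H m' /H.
    exact: minimal_below.
  by case=> g [Jg _] /upA; apply.
move=> G' subG /monomials_in_generated JG' m' [Jm' min_m'].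
(* Some element of [G'] divides [m']; by minimality it equals [m']. *)
have /(monomials_inX _ JG')[g G'g le_gm'] := Jm'.
by rewrite -(min_m' g) //; case: (subG _ G'g).
Qed.

(* For the monomial ideal spanned by [A], this says that the minimal generators
   are squarefree in every [b \in B] and that those divisible by [a] are
   divisible by some [b \in B]. *)
Definition star A a B : Prop :=
  (forall b m, b \in B -> A m -> (1 < m b)%N -> A (m - U_(b))%MM) /\
  (forall m, A m -> (0 < m a)%N ->
     A (m - U_(a))%MM \/ exists2 b, b \in B & (0 < m b)%N).

Lemma lem_subU m m' b : (m <= m')%MM -> (m b < m' b)%N -> (m <= m' - U_(b))%MM.
Proof.
move=> /mnm_lepP le_mm' lt_b; apply/mnm_lepP => i; rewrite mnmBE mnm1E.
by case: eqVneq => [<-|_] /=; [lia | rewrite subn0].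
Qed.

(** Pick a minimal generator [g] dividing [m]. Where the exponent of [m] exceeds that of [g], one
    variable can be removed from [m] while staying a multiple of [g]; otherwise the hypotheses on
    [g] decide. *)
Lemma star_conditionP J a (D : {set 'I_n}) B :
  monomial_ideal J -> B =i D -> star_condition J a D ->
  star (fun m => J 'X_[m]) a B.
Proof.
move=> monJ BD [sq_free cover]; have [_ upJ] := monomials_in_ideal monJ.
have below m : J 'X_[m] -> exists2 g, min_gen J g /\ J 'X_[g] & (g <= m)%MM.
  case/(@minimal_below (fun m => J 'X_[m])) => g min_g le_gm; exists g => //.
  by split; [exact: min_gen_minimal | case: min_g].
split=> [b m | m] => [bB|] /[dup] Jm /below[g [gen_g Jg] le_gm] m_gt.
  apply: upJ Jg _; apply: lem_subU => //.
  move: bB; rewrite BD => /sq_free[d [[J0 _]|[_ max_d]] d_le1].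
    (* The convention for the zero ideal is excluded, since [J] contains a monomial. *)
    by have /eqP := J0 _ Jm; rewrite -msupp_eq0 msuppX.
  by have := max_d g gen_g; lia.
have [g_a|g_a] := posnP (g a).
  by left; apply: upJ Jg _; apply: lem_subU; lia.
right; have [|b bD] := cover g gen_g; rewrite lep1mP -lt0n // => g_b.
by exists b; [rewrite BD | have /mnm_lepP/(_ b) := le_gm; lia].
Qed.

(** Any other way to obtain this monomial, as [x] times [m1] with [x] distinct from [b], would force
    [m1] to have larger [b]-degree than [m]. Hence nothing cancels. *)
Lemma msuppM_max B b g m :
  uniq B -> b \in B -> m \in msupp g ->
  (forall m', m' \in msupp g -> (m' b <= m b)%N) ->
  (U_(b) + m)%MM \in msupp ((\sum_(x <- B) 'X_x) * g).
Proof.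
move=> uB bB; rewrite !mcoeff_msupp => g_m max_m.
rewrite mulr_suml raddf_sum /= (bigD1_seq b) //= mulrC mcoeffMX big1 ?addr0 // => x ne_xb.
apply/eqP; rewrite mulrC mcoeff_eq0; apply/msuppMX_mem => -[m1 /max_m le_m1].
move/mnmP/(_ b); rewrite !mnmDE !mnm1E eqxx (negPf ne_xb); lia.
Qed.

Lemma seq_max (T : eqType) (s : seq T) (x : T) (v : T -> nat) :
  x \in s -> exists2 y, y \in s & forall z, z \in s -> (v z <= v y)%N.
Proof.
elim: s x => // y s IH x _; case: s IH => [|z s] IH.
  by exists y => [|z]; rewrite inE // => /eqP ->.
have [|w ws max_w] := IH z; first exact: mem_head.
have [le_wy|lt_yw] := leqP (v w) (v y).
  exists y => [|u]; first exact: mem_head.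
  by rewrite inE => /predU1P[->|/max_w] //; lia.
exists w => [|u]; first by rewrite inE ws orbT.
by rewrite inE => /predU1P[->|/max_w] //; lia.
Qed.

Lemma maxideal_sum B : maxideal (\sum_(x <- B) 'X_x : {mpoly K[n]}).
Proof.
elim/big_ind: _ => [||x _]; [exact: ideal_gen0 | exact: ideal_genD |].
by apply: mem_ideal_gen; exists x.
Qed.

(* If some monomial of [g] is divisible by some [b \in B], take one of maximal
   [b]-degree: its product with [b] survives in the product, hence lies in [A],
   and so does the monomial itself, [A] being squarefree in [b].  Otherwise
   argue in the same way with [a], no monomial being divisible by any [b]. *)
Lemma star_regular J A a B :
  up_closed A -> monomials_in J A -> uniq (a :: B) -> star A a B ->
  regular_on J (\sum_(x <- a :: B) 'X_x).
Proof.
move=> upA JA uaB [sq_free cover]; split; first exact: maxideal_sum.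
set f := \sum_(x <- _) _ => g.
have in_A h : J (f * h) -> h != 0 -> exists2 m, m \in msupp h & A m.
  move=> /JA fhA; rewrite -msupp_eq0 => h_nz.
  have [/hasP[m0 m0h /hasP[b bB m0b]] | no_b] :=
      boolP (has (fun m : 'X_{1..n} => has (fun b => 0 < m b)%N B) (msupp h)).
    have [m mh max_m] := seq_max (fun m : 'X_{1..n} => m b) m0h.
    exists m => //; have := sq_free b (U_(b) + m)%MM bB.
    rewrite addmC addmK; apply.
      by rewrite addmC; apply/fhA/msuppM_max => //; rewrite inE bB orbT.
    by have := max_m _ m0h; rewrite mnmDE mnm1E eqxx; lia.
  have [m0 m0h] : exists m, m \in msupp h.
    by case: (msupp h) h_nz => // m s _; exists m; exact: mem_head.
  have [m mh max_m] := seq_max (fun m : 'X_{1..n} => m a) m0h.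
  exists m => //; have /cover[] : A (m + U_(a))%MM.
  - by rewrite addmC; apply/fhA/msuppM_max => //; exact: mem_head.
  - by rewrite mnmDE mnm1E eqxx; lia.
  - by rewrite addmK.
  case=> b bB; rewrite mnmDE mnm1E; case: eqP => [ab|_].
    by move: uaB; rewrite /= ab bB.
  rewrite addn0 => m_b; case/negP: no_b.
  by apply/hasP; exists m => //; apply/hasP; exists b.
(* Induction on the number of terms of [g]: [in_A] yields a term lying in [J], and subtracting it
   preserves the hypothesis on [f * g]. *)
have [k] := ubnP (size (msupp g)); elim: k g => // k IH g lt_gk Jfg.
have [->|/(in_A g Jfg)[m mg Am]] := eqVneq g 0; first by apply/JA => m; rewrite msupp0.
have J_h p : J (p * (g@_m *: 'X_[m])).
  apply/JA => m'; rewrite -scalerAr => /msuppZ_le/msuppMX_mem[m1 _ ->].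
  by apply: upA Am _; exact: lem_addr.
suff /JA Jgh : J (g - g@_m *: 'X_[m]).
  have /JA Jh := J_h 1; rewrite mul1r in Jh.
  apply/JA => m'; rewrite -[g in msupp g](subrK (g@_m *: 'X_[m])) => /msuppD_le.
  by rewrite mem_cat => /orP[/Jgh|/Jh].
apply: IH; first by rewrite (perm_size (msupp_rem g m)) size_rem //; case: (msupp g) mg lt_gk.
move: Jfg (J_h f) => /JA Jfg /JA Jfh; rewrite mulrBr.
by apply/JA => m' /msuppB_le; rewrite mem_cat => /orP[/Jfg|/Jfh].
Qed.

End StarCondition.

(** * Adjoining elements to monomial spans, and initial ideals *)

Section IdealFacts.
Variables (K : fieldType) (n : nat).
Implicit Types (S T J : polyset K n) (p : {mpoly K[n]}).
Implicit Types (A G : 'X_{1..n} -> Prop) (m : 'X_{1..n}).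

Lemma ideal_gen_sub S T p :
  (forall h, S h -> ideal_gen T h) -> ideal_gen S p -> ideal_gen T p.
Proof.
move=> ST; move: p; apply: ideal_gen_ind => [|p1 p2|c p /ST].
- exact: ideal_gen0.
- exact: ideal_genD.
- exact: ideal_genMl.
Qed.

Lemma ideal_genN S p : ideal_gen S p -> ideal_gen S (- p).
Proof. by move/(ideal_genMl (- 1)); rewrite mulN1r. Qed.

Lemma monomials_in_ideal_gen J A p :
  up_closed A -> monomials_in J A -> ideal_gen J p <-> J p.
Proof.
move=> upA JA; split; last exact: mem_ideal_gen.
have /monomials_in_generated JG : monomials_in J (up_set A).
  move=> h; rewrite JA; split=> H m /H; last by case=> g /upA; apply.
  by exists m => //; exact: lepm_refl.
rewrite JG; apply: ideal_gen_sub => h; by rewrite JG.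
Qed.

Lemma adjoin_nil J A p :
  up_closed A -> monomials_in J A -> adjoin J [::] p <-> J p.
Proof.
move=> upA JA; rewrite -(monomials_in_ideal_gen p upA JA).
by split; apply: ideal_gen_sub => h Jh; apply: mem_ideal_gen; [case: Jh | left].
Qed.

Lemma monomials_in_initial le J :
  monomials_in (initial_ideal le J) (up_set (fun m => exists2 f, J f & is_lead le f m)).
Proof.
move=> p; rewrite -monomials_in_gen; split; apply: ideal_gen_sub => h.
  by case=> f [m [Jf lead_m ->]]; apply: mem_ideal_gen; exists m => //; exists f.
by case=> m [f Jf lead_m] ->; apply: mem_ideal_gen; exists f, m.
Qed.

Lemma monomials_in_ext J A A' :
  (forall m, A m <-> A' m) -> monomials_in J A -> monomials_in J A'.
Proof. by move=> AA' JA p; rewrite JA; split=> H m /H /AA'. Qed.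

End IdealFacts.

(** * Eliminating the variable [a] modulo ['X_a + 'X_c] *)

Section Substitution.
Variables (K : fieldType) (n : nat) (a c : 'I_n).
Hypothesis ne_ac : a != c.
Implicit Types (J L : polyset K n) (f g p : {mpoly K[n]}).
Implicit Types (A G : 'X_{1..n} -> Prop) (m : 'X_{1..n}).

(* The substitution of [- 'X_c] for ['X_a] on monomials, up to sign. *)
Definition subst_mnm m : 'X_{1..n} :=
  [multinom if i == a then 0 else if i == c then m a + m c else m i | i < n]%N.

Definition subst_poly p : {mpoly K[n]} :=
  p \mPo [tuple if i == a then - 'X_c else 'X_i | i < n].

Definition subst_set A : 'X_{1..n} -> Prop :=
  up_set (fun m => exists2 m0, A m0 & m = subst_mnm m0).

Definition monomial_span A : polyset K n :=
  fun p => forall m, m \in msupp p -> A m.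

Lemma monomial_spanP A : monomials_in (monomial_span A) A.
Proof. by []. Qed.

Lemma subst_polyM p1 p2 : subst_poly (p1 * p2) = subst_poly p1 * subst_poly p2.
Proof. by rewrite /subst_poly rmorphM. Qed.

Lemma subst_polyD p1 p2 : subst_poly (p1 + p2) = subst_poly p1 + subst_poly p2.
Proof. by rewrite /subst_poly rmorphD. Qed.

Lemma subst_polyXU x : subst_poly 'X_x = if x == a then - 'X_c else 'X_x.
Proof. by rewrite /subst_poly comp_mpolyXU -tnth_nth tnth_mktuple. Qed.

Lemma subst_polyX m : subst_poly 'X_[m] = (-1) ^+ m a *: 'X_[subst_mnm m].
Proof.
have ne_ca : c != a by rewrite eq_sym.
rewrite /subst_poly comp_mpolyX [in RHS]mpolyXE_id.
rewrite (bigD1 a) // (bigD1 c) //= [in RHS](bigD1 a) // [in RHS](bigD1 c) //=.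
rewrite !tnth_mktuple !mnmE !eqxx (negPf ne_ca) expr0 mul1r [in LHS]exprNn exprD -!mulrA.
rewrite -signr_odd -[in RHS]signr_odd scaler_sign mulr_sign.
under eq_bigr => i /andP[ne_ia ne_ic].
  rewrite (_ : _ ^+ _ = 'X_i ^+ subst_mnm m i); first by over.
  by rewrite tnth_mktuple mnmE (negPf ne_ia) (negPf ne_ic).
by [].
Qed.

Lemma msupp_subst m p :
  m \in msupp (subst_poly p) -> exists2 m1, m1 \in msupp p & m = subst_mnm m1.
Proof.
rewrite /subst_poly comp_mpolyEX => /msupp_subset_sum[m1 pm1] /msuppZ_le.
rewrite -/(subst_poly _) subst_polyX => /msuppZ_le; rewrite msuppX inE => /eqP ->.
by exists m1.
Qed.

Lemma subst_congr p : ideal_gen (fun h => h = 'X_a + 'X_c) (p - subst_poly p).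
Proof.
rewrite [p in p - _]mpolyE /subst_poly comp_mpolyEX -sumrB.
elim/big_ind: _ => [||m _]; [exact: ideal_gen0 | exact: ideal_genD |].
rewrite -scalerBr -mul_mpolyC; apply: ideal_genMl.
rewrite comp_mpolyX [X in _ (X - _)]mpolyXE_id (bigD1 a) //= [X in _ (_ - X)](bigD1 a) //=.
rewrite tnth_mktuple eqxx; under [X in _ - _ * X]eq_bigr => i ne_ia.
  by rewrite tnth_mktuple (negPf ne_ia); over.
rewrite -mulrBl mulrC; apply: ideal_genMl.
(* The difference of the [k]-th powers of ['X_a] and [- 'X_c] is divisible by ['X_a + 'X_c]. *)
rewrite subrXX opprK mulrC; apply: ideal_genMl; exact: mem_ideal_gen.
Qed.

Lemma subst_mnm_id m : m a = 0%N -> subst_mnm m = m.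
Proof.
move=> m_a; apply/mnmP => i; rewrite mnmE.
by case: eqP => [->|_] //; case: eqP => [->|_] //; rewrite m_a.
Qed.

Lemma subst_mnm_sub m x : (0 < m x)%N ->
  subst_mnm (m - U_(x)) = (subst_mnm m - U_(if x == a then c else x))%MM.
Proof.
move=> m_x; apply/mnmP => i; rewrite !(mnmE, mnmBE, mnm1E).
have [//|ne_ia] := eqVneq i a; have [eq_xa|ne_xa] := eqVneq x a.
  move: m_x; rewrite eq_xa [a == i]eq_sym (negPf ne_ia) (negPf ne_ac) [c == i]eq_sym.
  by case: eqP; lia.
have [eq_ic|//] := eqVneq i c; move: m_x; rewrite eq_ic.
by case: eqP => [->|_]; lia.
Qed.

(** The substitution kills ['X_a + 'X_c], fixes [fs] and sends [J] into the new monomial ideal.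
    Conversely, every polynomial is congruent to its image modulo ['X_a + 'X_c], so membership can
    be pulled back. *)
Lemma adjoin_subst J A fs g :
  monomials_in J A -> (forall h, h \in fs -> subst_poly h = h) ->
  adjoin J ('X_a + 'X_c :: fs) g <->
  adjoin (monomial_span (subst_set A)) fs (subst_poly g).
Proof.
move=> JA fs_fixed; split.
  move: g; apply: ideal_gen_ind => [|g1 g2|d g].
  - by rewrite /subst_poly raddf0; exact: ideal_gen0.
  - by rewrite subst_polyD; exact: ideal_genD.
  rewrite subst_polyM => Sg; apply: ideal_genMl; case: Sg => [/JA Ag|].
    apply: mem_ideal_gen; left=> _ /msupp_subst[m /Ag Am ->].
    by exists (subst_mnm m); [exists m | exact: lepm_refl].
  rewrite inE => /predU1P[->|fs_g]; last by rewrite fs_fixed //; apply: mem_ideal_gen; right.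
  by rewrite subst_polyD !subst_polyXU eqxx eq_sym (negPf ne_ac) addNr; exact: ideal_gen0.
have congr p : adjoin J ('X_a + 'X_c :: fs) (p - subst_poly p).
  apply: ideal_gen_sub (subst_congr p) => h ->.
  by apply: mem_ideal_gen; right; exact: mem_head.
move=> Hg; rewrite -(subrK (subst_poly g) g); apply: ideal_genD; first exact: congr.
apply: ideal_gen_sub Hg => h [/monomials_in_gen|fs_h]; last first.
  by apply: mem_ideal_gen; right; rewrite inE fs_h orbT.
apply: ideal_gen_sub => _ [_ [m Am ->] ->].
(* Up to sign, the image monomial is an element of [J] minus an element of the ideal generated by
   ['X_a + 'X_c]. *)
have -> : 'X_[subst_mnm m] = (-1) ^+ m a *: (('X_[m] : {mpoly K[n]}) - ('X_[m] - subst_poly 'X_[m])).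
  by rewrite subKr subst_polyX scalerA -exprMn mulrNN mulr1 expr1n scale1r.
rewrite -mul_mpolyC; apply/ideal_genMl/ideal_genD; last exact/ideal_genN/congr.
by apply: mem_ideal_gen; left; apply/(monomials_inX _ JA).
Qed.

(** Let [m] be a multiple of the image of [m0]. If [m] has strictly more of a variable than this
    image, that variable can be removed; otherwise the condition is applied to [m0] and carried
    through the substitution. *)
Lemma star_subst A x B :
  star A a [:: c] -> star A x B -> a \notin x :: B -> c \notin B ->
  star (subst_set A) x B.
Proof.
move=> [_ cover_a] [sq_free cover]; rewrite inE negb_or => /andP[ne_ax aB] cB.
have le_sub m m' y : (subst_mnm m <= m')%MM -> (subst_mnm m y < m' y)%N ->
    A m -> subst_set A (m' - U_(y))%MM.
  by move=> le_m lt_m Am; exists (subst_mnm m); [exists m | apply: lem_subU].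
have le_sub2 m m' y : (subst_mnm m <= m')%MM -> (0 < m y)%N -> A (m - U_(y))%MM ->
    subst_set A (m' - U_(if y == a then c else y))%MM.
  move=> le_m m_y Am; exists (subst_mnm (m - U_(y))); first by exists (m - U_(y))%MM.
  rewrite subst_mnm_sub //; apply/mnm_lepP => i; rewrite !mnmBE.
  by apply: leq_sub2r; apply/mnm_lepP.
have substB m y : y \in B -> subst_mnm m y = m y.
  move=> yB; rewrite mnmE; case: eqP => [ya|_]; first by rewrite -ya yB in aB.
  by case: eqP => [yc|//]; rewrite -yc yB in cB.
split=> [y m yB|m] [_ [m0 Am0 ->] le_m] m_gt.
  have [m0_y|m0_y] := leqP (m0 y) 1.
    by apply: le_sub le_m _ Am0; rewrite substB //; lia.
  have := le_sub2 _ _ _ le_m (ltnW m0_y) (sq_free _ _ yB Am0 m0_y).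
  by case: eqP yB aB => // -> ->.
have [lt_m|ge_m] := ltnP (subst_mnm m0 x) (m x); first by left; apply: le_sub le_m _ Am0.
have [m0_x|m0_x] := posnP (m0 x).
  (* As [m0] is free of [x], its image can contain [x] only if [x = c], all of it coming from [a].
     The condition on [a] then allows removing an [a] from [m0], its alternative being that [c]
     divides [m0]. *)
  move: ge_m; rewrite mnmE eq_sym (negPf ne_ax); case: eqP => [xc|_]; last by lia.
  subst x; rewrite m0_x addn0 => ge_m.
  have [|Am1|[y]] := cover_a _ Am0; first by lia.
    by left; have := le_sub2 _ _ a le_m; rewrite eqxx; apply=> //; lia.
  by rewrite inE => /eqP ->; rewrite m0_x.
have [Am1|[y yB m0_y]] := cover _ Am0 m0_x.
  by left; have := le_sub2 _ _ _ le_m m0_x Am1; rewrite eq_sym (negPf ne_ax).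
by right; exists y => //; move/mnm_lepP/(_ y): le_m; rewrite substB //; lia.
Qed.

(** * The initial ideal after adjoining ['X_a + 'X_c] *)

Section Initial.
Variable le : rel 'X_{1..n}.
Hypothesis le_order : term_order le.
Hypothesis lt_ca : term_lt le U_(c)%MM U_(a)%MM.

Definition initial_subst_set A m : Prop := subst_set A m \/ (0 < m a)%N.

Lemma initial_subst_closed A : up_closed (initial_subst_set A).
Proof.
move=> m m' [/up_set_closed up|m_a] le_mm'; first by left; apply: up.
by right; apply: leq_trans m_a (mnm_lepP le_mm' a).
Qed.

Lemma le_subst_mnm m : le (subst_mnm m) m.
Proof.
have [[refl_le _ trans_le _] [le_add _]] := le_order.
have le_pow k : le (U_(c) *+ k)%MM (U_(a) *+ k)%MM.
  elim: k => [|k IH]; first exact: refl_le.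
  have /andP[_ le_ca] := lt_ca.
  rewrite !mulmS; apply: trans_le (le_add _ _ (U_(a) *+ k)%MM le_ca).
  by rewrite ![(U_(c) + _)%MM]addmC; apply: le_add.
(* With [r] the [a]-free part of [m], passing to the image replaces a power of [a] by the same power
   of [c] and keeps [r]. *)
pose r := [multinom if i == a then 0 else m i | i < n]%N.
have -> : subst_mnm m = (U_(c) *+ m a + r)%MM.
  apply/mnmP => i; rewrite mnmDE mulmnE mnm1E !mnmE.
  have [->|_] := eqVneq i a; first by rewrite eq_sym (negPf ne_ac).
  by have [->|] := eqVneq i c; [rewrite mul1n|].
rewrite [leRHS in le _ leRHS](_ : m = (U_(a) *+ m a + r)%MM).
  exact/le_add/le_pow.
apply/mnmP => i; rewrite mnmDE mulmnE mnm1E !mnmE.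
by have [->|_] := eqVneq i a; [rewrite mul1n addn0 | ].
Qed.

(* If the substitution sends another monomial [m'] of [g] to [m], then [m <= m']
   by [le_subst_mnm], so [m] does not cancel. *)
Lemma lead_subst g m : is_lead le g m -> m a = 0%N -> m \in msupp (subst_poly g).
Proof.
have [[_ anti_le _ _] _] := le_order.
move=> [gm max_m] m_a; rewrite mcoeff_msupp /subst_poly comp_mpolyEX raddf_sum /=.
rewrite (bigD1_seq m) //= big_seq_cond big1 ?addr0 => [|m' /andP[gm' ne_m'm]].
  rewrite -/(subst_poly _) subst_polyX m_a expr0 scale1r subst_mnm_id //.
  by rewrite mcoeffZ mcoeffX eqxx mulr1 -mcoeff_msupp.
rewrite -/(subst_poly _) subst_polyX !mcoeffZ mcoeffX.
case: eqP => [sub_m'|_]; last by rewrite !mulr0.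
by case/eqP: ne_m'm; apply: anti_le; rewrite max_m //= -sub_m' le_subst_mnm.
Qed.

(** A leading monomial free of [a] survives the substitution by [lead_subst], hence lies in the
    substituted ideal. Conversely, the image monomials are [a]-free elements of the ideal, and [a]
    leads ['X_a + 'X_c]. *)
Lemma monomials_in_initial_subst J A :
  monomials_in J A ->
  monomials_in (initial_ideal le (adjoin J [:: 'X_a + 'X_c])) (initial_subst_set A).
Proof.
have [[refl_le _ _ _] _] := le_order.
move=> JA; set L := adjoin J _.
have L_subst g : L g <-> monomial_span (subst_set A) (subst_poly g).
  rewrite /L (adjoin_subst _ JA) //.
  by rewrite (adjoin_nil _ (@up_set_closed _ _) (monomial_spanP (subst_set A))).
apply: monomials_in_ext (monomials_in_initial le L) => m; split.
  case=> m1 [g /L_subst Ag lead_m1]; apply: initial_subst_closed.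
  have [m1_a|m1_a] := posnP (m1 a); last by right.
  by left; apply/Ag/lead_subst.
case=> [[_ [m0 Am0 ->] le_m]|m_a].
  exists (subst_mnm m0) => //; exists 'X_[subst_mnm m0].
    apply/L_subst; rewrite subst_polyX (@subst_mnm_id (subst_mnm m0)); last by rewrite mnmE eqxx.
    move=> m1 /msuppZ_le; rewrite msuppX inE => /eqP ->.
    by exists (subst_mnm m0); [exists m0 | exact: lepm_refl].
  by split=> [|m']; rewrite msuppX inE // => /eqP ->.
exists U_(a)%MM; last by rewrite lep1mP -lt0n.
exists ('X_a + 'X_c); first by apply: mem_ideal_gen; right; exact: mem_head.
split; first by rewrite mcoeff_msupp mcoeffD !mcoeffXU eqxx [c == a]eq_sym (negPf ne_ac) addr0 oner_eq0.
move=> m' /msuppD_le; rewrite mem_cat !msuppX !inE => /orP[]/eqP -> //.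
by case/andP: lt_ca.
Qed.

(** Multiples of [a] stay multiples of [a] when another variable is removed, so adding [a] to the
    ideal is harmless. *)
Lemma star_initial_subst A x B :
  star A a [:: c] -> star A x B -> a \notin x :: B -> c \notin B ->
  star (initial_subst_set A) x B.
Proof.
move=> star_a star_x axB cB.
have [sq_free cover] := star_subst star_a star_x axB cB.
have sub_a m y : y \in x :: B -> (0 < m a)%N -> initial_subst_set A (m - U_(y))%MM.
  move=> yxB m_a; right; rewrite mnmBE mnm1E.
  by case: eqP yxB axB => [->->|_] //; rewrite subn0.
split=> [y m yB|m] [Am|m_a] m_gt.
- by left; apply: sq_free.
- by apply: sub_a => //; rewrite inE yB orbT.
- by case: (cover _ Am m_gt); [left; left | right].
- by left; apply: sub_a => //; exact: mem_head.
Qed.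

End Initial.

End Substitution.

(** * Induction along the chain of sets of variables *)

Section Chain.
Variables (K : fieldType) (n : nat) (b : nat -> 'I_n) (q t : nat).
Hypothesis b_distinct : forall i j : nat,
  (i <= t)%N -> (j <= t)%N -> b i = b j -> i = j.
Hypothesis q_range : (1 <= q <= t)%N.
Implicit Types (J : polyset K n) (A : 'X_{1..n} -> Prop).

(** The non-distinguished elements of the [i]-th set, counted from [1]; the distinguished one is
    [b i.-1]. *)
Definition star_tail i : seq 'I_n :=
  if (i < q)%N then [:: b i] else map b (index_iota q t.+1).

Lemma star_tailP i x : (i <= q)%N -> x \in star_tail i ->
  exists2 j, (i <= j <= t)%N & x = b j.
Proof.
rewrite /star_tail; case: ltnP => [lt_iq|ge_iq] le_iq.
  by rewrite inE => /eqP ->; exists i => //; lia.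
by case/mapP=> j; rewrite mem_index_iota => j_range ->; exists j => //; lia.
Qed.

Lemma star_formE i : (i <= q)%N ->
  star_form K b q t i = \sum_(x <- b i.-1 :: star_tail i) 'X_x.
Proof.
rewrite /star_form /star_tail big_cons; case: ltnP => [_|ge_iq] le_iq.
  by rewrite big_seq1.
have -> : i = q by lia.
by rewrite big_map [LHS]big_ltn ?prednK //; lia.
Qed.

Lemma star_tail_notin i j : (i < j)%N -> (j <= q)%N -> b i \notin star_tail j.
Proof.
by move=> lt_ij le_jq; apply/negP => /(star_tailP le_jq)[k k_range /b_distinct]; lia.
Qed.

Lemma star_tail_uniq i : (0 < i <= q)%N -> uniq (b i.-1 :: star_tail i).
Proof.
move=> i_range; rewrite /= star_tail_notin /=; [|lia..].
rewrite /star_tail; case: ifP => // _; rewrite map_inj_in_uniq ?iota_uniq //.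
by move=> x y; rewrite !mem_index_iota => x_range y_range; apply: b_distinct; lia.
Qed.

(** What remains to be assumed once the first [i] forms have been processed. *)
Definition star_chain A i : Prop :=
  forall j, (i < j <= q)%N -> star A (b j.-1) (star_tail j).

Lemma star_chain_regular J A i :
  up_closed A -> monomials_in J A -> star_chain A i -> (i < q)%N ->
  regular_on J (star_form K b q t i.+1).
Proof.
move=> upA JA chA lt_iq; rewrite star_formE //.
by apply: star_regular (chA _ _) => //; [apply: star_tail_uniq|]; lia.
Qed.

Lemma b_neqS i : (i < q)%N -> b i != b i.+1.
Proof. by move=> lt_iq; apply/eqP => /b_distinct; lia. Qed.

Lemma star_formS i : (i.+1 < q)%N -> star_form K b q t i.+1 = 'X_(b i) + 'X_(b i.+1).
Proof. by rewrite /star_form => ->. Qed.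

Lemma star_chain_pair A i : star_chain A i -> (i.+1 < q)%N -> star A (b i) [:: b i.+1].
Proof. by move=> chA lt_iq; have := chA i.+1; rewrite /star_tail lt_iq; apply; lia. Qed.

(** The side conditions of [star_subst]: the eliminated [b i] never recurs, while [b i.+1] may recur
    only as a distinguished element. *)
Lemma star_chain_notin i j : (i.+1 < j <= q)%N ->
  b i \notin b j.-1 :: star_tail j /\ b i.+1 \notin star_tail j.
Proof.
move=> j_range; rewrite inE negb_or !star_tail_notin ?andbT; [|lia..].
by split=> //; apply/eqP => /b_distinct; lia.
Qed.

Lemma star_chain_subst A i : star_chain A i -> (i.+1 < q)%N ->
  star_chain (subst_set (b i) (b i.+1) A) i.+1.
Proof.
move=> chA lt_iq j j_range; have [ni nSi] := star_chain_notin j_range.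
by apply: star_subst => //; [apply: b_neqS; lia | exact: star_chain_pair | apply: chA; lia].
Qed.

Lemma star_chain_initial A i : star_chain A i -> (i.+1 < q)%N ->
  star_chain (initial_subst_set (b i) (b i.+1) A) i.+1.
Proof.
move=> chA lt_iq j j_range; have [ni nSi] := star_chain_notin j_range.
by apply: star_initial_subst => //; [apply: b_neqS; lia | exact: star_chain_pair | apply: chA; lia].
Qed.

Lemma star_form_fixed i j : (i.+1 < j <= q)%N ->
  subst_poly (b i) (b i.+1) (star_form K b q t j) = star_form K b q t j.
Proof.
move=> j_range; have [ni _] := star_chain_notin j_range.
rewrite star_formE; last by lia.
rewrite /subst_poly raddf_sum /= !big_seq; apply: eq_bigr => x xs.
rewrite -/(subst_poly _ _ _) subst_polyXU; case: eqP => // xb.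
by rewrite -xb xs in ni.
Qed.

(** Induction on the number [k] of adjoined forms: the first one is eliminated by substitution,
    which fixes the later forms but changes the ideal, so [J] and [A] must vary. *)
Lemma star_chain_regular_adjoin J A i k :
  up_closed A -> monomials_in J A -> star_chain A i -> (i + k < q)%N ->
  regular_on (adjoin J [seq star_form K b q t j | j <- iota i.+1 k])
    (star_form K b q t (i + k).+1).
Proof.
elim: k i J A => [|k IH] i J A upA JA chA lt_q.
  rewrite addn0; have [mf regf] := star_chain_regular upA JA chA (ltac:(lia)).
  by split=> // g; rewrite !(adjoin_nil _ upA JA); apply: regf.
have lt_iq : (i.+1 < q)%N by lia.
have ne_b : b i != b i.+1 by apply: b_neqS; lia.
pose A' := subst_set (b i) (b i.+1) A.
have := IH i.+1 _ A' (@up_set_closed _ _) (monomial_spanP A') (star_chain_subst chA lt_iq).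
rewrite addSnnS => /(_ lt_q)[mf regf]; split=> // g /=.
rewrite (star_formS lt_iq) !(adjoin_subst ne_b _ JA); try first
  [ by move=> h /mapP[j]; rewrite mem_iota => j_range ->; apply: star_form_fixed; lia].
rewrite subst_polyM star_form_fixed; [exact: regf | lia].
Qed.

(** After the first form, the initial ideal is again a monomial span with the star conditions for
    the later sets, so the induction hypothesis applies to it directly. *)
Lemma star_chain_regular_initial le J A i k :
  term_order le ->
  (forall j, (j < t)%N -> term_lt le U_(b j.+1)%MM U_(b j)%MM) ->
  up_closed A -> monomials_in J A -> star_chain A i -> (i + k < q)%N ->
  regular_on
    (foldl (fun L f => initial_ideal le (adjoin L [:: f])) J
       [seq star_form K b q t j | j <- iota i.+1 k])
    (star_form K b q t (i + k).+1).
Proof.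
move=> le_order b_decr; elim: k i J A => [|k IH] i J A upA JA chA lt_q.
  by rewrite addn0 in lt_q *; apply: star_chain_regular JA chA _.
have lt_iq : (i.+1 < q)%N by lia.
rewrite -addSnnS in lt_q *; rewrite /= (star_formS lt_iq).
apply: IH (initial_subst_set (b i) (b i.+1) A) _ _ _ lt_q.
- exact: initial_subst_closed.
- by apply: monomials_in_initial_subst => //; [apply: b_neqS | apply: b_decr]; lia.
- exact: star_chain_initial.
Qed.

(** The distinguished variable occurs once in the sum, so its coefficient is [1]. *)
Lemma star_form_nonconstant i (c : K) :
  (0 < i <= q)%N -> star_form K b q t i <> c%:MP.
Proof.
move=> i_range /(congr1 (mcoeff U_(b i.-1))); rewrite star_formE; last by lia.
have /andP[ni _] := star_tail_uniq i_range.
rewrite big_cons mcoeffD mcoeffXU eqxx mcoeffC mnm1_eq0 mulr0 raddf_sum /= big_seq big1.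
  by rewrite addr0 => /eqP; rewrite oner_eq0.
move=> x xs; rewrite mcoeffXU; case: eqP => // xb; by rewrite -xb xs in ni.
Qed.

End Chain.

Theorem theorem4p13 (K : fieldType) (n : nat) (I : polyset K n)
    (le : rel 'X_{1..n}) (t q : nat) (b : nat -> 'I_n)
    (I_monomial : monomial_ideal I)
    (I_proper : is_proper I)
    (le_term_order : term_order le)
    (b_distinct : forall i j : nat,
       (i <= t)%N -> (j <= t)%N -> b i = b j -> i = j)
    (b_decreasing : forall i : nat,
       (i < t)%N -> term_lt le U_(b i.+1)%MM U_(b i)%MM)
    (q_range : (1 <= q <= t)%N)
    (pair_condition : forall i : nat,
       (1 <= i < q)%N -> star_condition I (b i.-1) [set b i])
    (last_condition :
       star_condition I (b q.-1)
         [set x | [exists j : 'I_t.+1, (q <= j)%N && (x == b j)]]) :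
  let fs := [seq star_form K b q t i | i <- iota 1 q] in
  regular_sequence I fs /\ initially_regular_sequence le I fs.
Proof.
move=> fs; have [IA upA] := monomials_in_ideal I_monomial.
have chain : star_chain b q t (fun m => I 'X_[m]) 0.
  move=> j j_range; rewrite /star_tail; have [lt_jq|ge_jq] := ltnP j q.
    apply: star_conditionP (pair_condition j _) => //; last by lia.
    by move=> x; rewrite !inE.
  have -> : j = q by lia.
  apply: star_conditionP last_condition => // x; rewrite inE.
  apply/mapP/existsP => [[k]|[k /andP[le_qk /eqP ->]]].
    rewrite mem_index_iota => /andP[le_qk lt_kt] ->.
    by exists (Ordinal lt_kt); rewrite /= le_qk eqxx.
  by exists (k : nat) => //; rewrite mem_index_iota le_qk ltn_ord.
have size_fs : size fs = q by rewrite size_map size_iota.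
have take_fs i : (i < q)%N -> take i fs = [seq star_form K b q t j | j <- iota 1 i].
  by move=> lt_iq; rewrite -map_take take_iota (minn_idPl (ltnW lt_iq)).
have nth_fs i : (i < q)%N -> fs`_i = star_form K b q t i.+1.
  by move=> lt_iq; rewrite (nth_map 0%N) ?size_iota // nth_iota // add1n.
split=> [i|]; first rewrite size_fs => lt_iq.
  by rewrite take_fs // nth_fs //; apply: star_chain_regular_adjoin IA chain _.
split=> // [f /mapP[j]|i].
  rewrite mem_iota => j_range -> [c]; apply: star_form_nonconstant => //; lia.
rewrite size_fs => lt_iq; rewrite take_fs // nth_fs //.
(* A monomial ideal is its own initial ideal, so the iteration starts from [I]. *)
have IinA : monomials_in (initial_ideal le I) (fun m => I 'X_[m]).
  apply: monomials_in_ext (monomials_in_initial le I) => m; split.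
    by case=> m1 [f /IA If [/If Im1 _]] /upA; apply.
  move=> Im; exists m; last exact: lepm_refl.
  exists 'X_[m] => //; split=> [|m']; rewrite msuppX inE // => /eqP ->.
  by case: le_term_order => -[].
exact: star_chain_regular_initial IinA chain _.
Qed.
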